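(* Let $Q$ be a smooth manifold with a Riemannian metric, let $\mathcal{D}\subset TQ$ be a smooth distribution of constant rank, and let $\mathcal{P}\colon TQ\to\mathcal{D}$, $\mathcal{Q}\colon TQ\to\mathcal{D}^\perp$ be the complementary orthogonal projectors. Let a Lie group $G$ with Lie algebra $\mathfrak{g}$ act smoothly on $Q$, let $L_d\colon Q\times Q\to\mathbb{R}$ be a smooth discrete Lagrangian that is $G$-invariant, i.e. $L_d(hq_0,hq_1)=L_d(q_0,q_1)$ for all $h\in G$, $q_0,q_1\in Q$, and let $\xi\in\mathfrak{g}$ be a horizontal symmetry. Then the nonholonomic integrator $$\mathcal{P}^*_{q_k}\big(D_1L_d(q_k,q_{k+1})\big)+\mathcal{P}^*_{q_k}\big(D_2L_d(q_{k-1},q_k)\big)=0,\qquad \mathcal{Q}^*_{q_k}\big(D_1L_d(q_k,q_{k+1})\big)-\mathcal{Q}^*_{q_k}\big(D_2L_d(q_{k-1},q_k)\big)=0$$ preserves the function $(J^{\mathrm{nh}}_d)_\xi$; that is, whenever $q_{k-1},q_k,q_{k+1}\in Q$ satisfy these two equations, $$(J^{\mathrm{nh}}_d)_\xi(q_k,q_{k+1})=(J^{\mathrm{nh}}_d)_\xi(q_{k-1},q_k).$$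
   Context: $D_1L_d(q_0,q_1)\in T^*_{q_0}Q$ and $D_2L_d(q_0,q_1)\in T^*_{q_1}Q$ denote the partial differentials of $L_d$. $\mathcal{D}^\perp$ is the orthogonal complement of $\mathcal{D}$ with respect to the Riemannian metric. For $q\in Q$, $\mathcal{P}_q,\mathcal{Q}_q$ are the orthogonal projections of $T_qQ$ onto $\mathcal{D}_q$, $\mathcal{D}_q^\perp$, regarded as endomorphisms of $T_qQ$, and $\mathcal{P}_q^*,\mathcal{Q}_q^*\colon T_q^*Q\to T_q^*Q$ are their dual maps. For $\xi\in\mathfrak{g}$, $\xi_Q$ is the infinitesimal generator $\xi_Q(q)=\frac{d}{ds}\big|_{s=0}\exp(s\xi)q$. A horizontal symmetry is an element $\xi\in\mathfrak{g}$ such that $\xi_Q(q)\in\mathcal{D}_q$ for all $q\in Q$. For a horizontal symmetry $\xi$, the corresponding component of the discrete nonholonomic momentum map is $(J^{\mathrm{nh}}_d)_\xi\colon Q\times Q\to\mathbb{R}$, $(J^{\mathrm{nh}}_d)_\xi(q_0,q_1)=\langle D_2L_d(q_0,q_1),\xi_Q(q_1)\rangle$. *)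

(* Defs.v *)
From HB Require Import structures.
From mathcomp Require Import all_boot all_order all_algebra sesquilinear.
From mathcomp Require Import all_classical all_reals all_analysis.
Set Implicit Arguments.
Unset Strict Implicit.
Unset Printing Implicit Defensive.
Import Order.TTheory GRing.Theory Num.Theory.
Import numFieldNormedType.Exports.
Local Open Scope classical_set_scope.
Local Open Scope ring_scope.

(** C^oo on an open set [U]: every iterated directional derivative of [f] is
    Frechet differentiable at every point of [U]. *)
Definition smooth_on (R : realType) (V W : normedModType R)
    (U : set V) (f : V -> W) : Prop :=
  forall (vs : seq V) (x : V), U x ->
    differentiable (foldr (fun v h => 'D_v h) f vs) x.

(** A chart is a partial bijection between [chart_dom] and [chart_cod]; the
    values of the two total functions outside of these sets are irrelevant. *)
Record chart (R : realType) (T : topologicalType) (V : normedModType R) :=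
  Chart {
    chart_dom : set T;
    chart_cod : set V;
    chart_fun :> T -> V;
    chart_inv : V -> T
  }.

Record is_chart (R : realType) (T : topologicalType) (V : normedModType R)
    (c : chart T V) : Prop := IsChart {
  chart_dom_open : open (chart_dom c);
  chart_cod_open : open (chart_cod c);
  chart_fun_cod : forall q, chart_dom c q -> chart_cod c (c q);
  chart_inv_dom : forall x, chart_cod c x -> chart_dom c (chart_inv c x);
  chart_funK : forall q, chart_dom c q -> chart_inv c (c q) = q;
  chart_invK : forall x, chart_cod c x -> c (chart_inv c x) = x;
  chart_fun_continuous : forall q, chart_dom c q -> {for q, continuous c};
  chart_inv_continuous :
    forall x, chart_cod c x -> {for x, continuous (chart_inv c)}
}.

Definition model_atlas (R : realType) (V : normedModType R) :
    set (chart V V) :=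
  [set Chart setT setT id id].

Definition prod_chart (R : realType) (T T' : topologicalType)
    (V V' : normedModType R) (c : chart T V) (d : chart T' V') :
    chart (T * T')%type (V * V')%type :=
  Chart (chart_dom c `*` chart_dom d) (chart_cod c `*` chart_cod d)
    (fun p => (c p.1, d p.2)) (fun x => (chart_inv c x.1, chart_inv d x.2)).

Definition prod_atlas (R : realType) (T T' : topologicalType)
    (V V' : normedModType R) (A : set (chart T V)) (B : set (chart T' V')) :
    set (chart (T * T')%type (V * V')%type) :=
  [set e | exists c d, [/\ A c, B d & e = prod_chart c d]].

Definition smooth_map (R : realType) (T T' : topologicalType)
    (V V' : normedModType R) (A : set (chart T V)) (B : set (chart T' V'))
    (f : T -> T') : Prop :=
  continuous f /\
  forall c d, A c -> B d ->
    smooth_on (chart_cod c `&` (f \o chart_inv c) @^-1` chart_dom d)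
      (d \o f \o chart_inv c).

HB.mixin Record Topological_isManifold (R : realType) (n : nat) M
    of Topological M := {
  atlas : set (chart M 'rV[R]_n);
  atlas_chart : forall c, atlas c -> is_chart c;
  atlas_cover : forall q : M, exists2 c, atlas c & chart_dom c q;
  atlas_compat : forall c d, atlas c -> atlas d ->
    smooth_on (chart_cod c `&` chart_inv c @^-1` chart_dom d)
      (d \o chart_inv c);
  manifold_hausdorff : hausdorff_space M;
  manifold_second_countable : @second_countable M
}.

#[short(type="manifoldType")]
HB.structure Definition Manifold (R : realType) (n : nat) :=
  {M of Topological_isManifold R n M & Topological M}.

Arguments atlas {R n} s.

Section Tangent.
Context {R : realType} {n : nat} {M : manifoldType R n}.
Implicit Types (q : M) (c : chart M 'rV[R]_n).

Definition chart_at q : chart M 'rV[R]_n := s2val (cid2 (atlas_cover q)).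

(** A tangent vector at [q] is represented by its components in the chart
    [chart_at q]. Its components in another chart [c] around [q] are obtained by
    applying the differential of the transition map, see [tangent_coord]. *)
Definition tangent q : vectType R := 'rV[R]_n.

Definition cotangent q : vectType R := 'Hom(tangent q, R^o).

Definition tangent_coord c q (v : tangent q) : 'rV[R]_n :=
  'd (c \o chart_inv (chart_at q)) (chart_at q q) v.

(** The tangent vector at [chart_inv c x] with components [u] in [c]. *)
Definition tangent_of_coord c (x : 'rV[R]_n) (u : 'rV[R]_n) :
    tangent (chart_inv c x) :=
  'd (chart_at (chart_inv c x) \o chart_inv c) x u.

(** The velocity at time 0 of a curve [gamma] such that [gamma 0 = q]. *)
Definition velocity q (gamma : R -> M) : tangent q :=
  derive1 (chart_at q \o gamma) 0.

Definition differential (f : M -> R) q : cotangent q :=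
  linfun ('d (f \o chart_inv (chart_at q) : 'rV[R]_n -> R^o) (chart_at q q)).

Definition dual_map q (P : 'End(tangent q)) (alpha : cotangent q) :
    cotangent q :=
  (alpha \o P)%VF.

Definition smooth_field_on (U : set M) (X : forall q, tangent q) : Prop :=
  forall c, atlas M c ->
    smooth_on (chart_cod c `&` chart_inv c @^-1` U)
      (fun x => tangent_coord c (X (chart_inv c x))).

End Tangent.

Record riemannian_metric (R : realType) (n : nat) (M : manifoldType R n) :=
  RiemannianMetric {
    metric_form :> forall q : M, {dot tangent q for idfun};
    metric_smooth : forall c, atlas M c -> forall u v : 'rV[R]_n,
      smooth_on (chart_cod c) (fun x : 'rV[R]_n =>
        metric_form (chart_inv c x) (tangent_of_coord c x u)
          (tangent_of_coord c x v) : R^o)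
  }.

Record smooth_distribution (R : realType) (n : nat) (M : manifoldType R n)
    (r : nat) :=
  SmoothDistribution {
    dist_space :> forall q : M, {vspace tangent q};
    dist_rank : forall q, \dim (dist_space q) = r;
    dist_smooth : forall q0 : M, exists2 U, open_nbhs q0 U &
      exists X : 'I_r -> forall q : M, tangent q,
        (forall i, smooth_field_on U (X i)) /\
        (forall q, U q -> dist_space q = <<[seq X i q | i : 'I_r]>>%VS)
  }.

Section Projections.
Context {R : realType} {n r : nat} {M : manifoldType R n}.
Variables (g : riemannian_metric M) (D : smooth_distribution M r).

Definition dist_perp (q : M) : {vspace tangent q} := orthov (g q) (D q).

(** [daddv_pi U V] is the projection onto [U] along [V]. *)
Definition proj_dist (q : M) : 'End(tangent q) :=
  daddv_pi (D q) (dist_perp q).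

Definition proj_perp (q : M) : 'End(tangent q) :=
  daddv_pi (dist_perp q) (D q).

End Projections.

HB.mixin Record Manifold_isLieGroup (R : realType) (m : nat) G
    of Manifold R m G & Group G := {
  mulg_smooth : smooth_map (prod_atlas (atlas G) (atlas G)) (atlas G)
    (fun p : G * G => p.1 * p.2)%g;
  invg_smooth : smooth_map (atlas G) (atlas G) (fun x : G => x^-1)%g
}.

#[short(type="lieGroupType")]
HB.structure Definition LieGroup (R : realType) (m : nat) :=
  {G of Manifold_isLieGroup R m G & Manifold R m G & Group G}.

Section LieGroups.
Context {R : realType} {m : nat} {G : lieGroupType R m}.

Definition lie_algebra : vectType R := tangent (1%g : G).

Definition one_param_subgroup (xi : lie_algebra) (gamma : R -> G) : Prop :=
  [/\ smooth_map (@model_atlas R R^o) (atlas G) gamma,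
      forall s t, gamma (s + t) = (gamma s * gamma t)%g &
      velocity 1%g gamma = xi].

(** [gamma 1], where [gamma] is the unique one-parameter subgroup with initial
    velocity [xi]. *)
Definition lie_exp (xi : lie_algebra) : G :=
  xget 1%g [set gamma 1 | gamma in one_param_subgroup xi].

End LieGroups.
Arguments lie_algebra {R m} G.

Section Actions.
Context {R : realType} {n m : nat} {Q : manifoldType R n}
  {G : lieGroupType R m}.
Variable act : G -> Q -> Q.

Definition smooth_action : Prop :=
  [/\ smooth_map (prod_atlas (atlas G) (atlas Q)) (atlas Q)
        (fun p : G * Q => act p.1 p.2),
      forall q, act 1%g q = q &
      forall h k q, act (h * k)%g q = act h (act k q)].

Definition inf_generator (xi : lie_algebra G) (q : Q) : tangent q :=
  velocity q (fun s : R => act (lie_exp (s *: xi)) q).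

Definition horizontal_symmetry (r : nat) (D : smooth_distribution Q r)
    (xi : lie_algebra G) : Prop :=
  forall q, inf_generator xi q \in D q.

End Actions.

Section DiscreteLagrangian.
Context {R : realType} {n m : nat} {Q : manifoldType R n}
  {G : lieGroupType R m}.
Variables (act : G -> Q -> Q) (Ld : Q * Q -> R).

Definition smooth_lagrangian : Prop :=
  smooth_map (prod_atlas (atlas Q) (atlas Q)) (@model_atlas R R^o) Ld.

Definition invariant_lagrangian : Prop :=
  forall (h : G) (q0 q1 : Q), Ld (act h q0, act h q1) = Ld (q0, q1).

Definition D1 (q0 q1 : Q) : cotangent q0 :=
  differential (fun q => Ld (q, q1)) q0.

Definition D2 (q0 q1 : Q) : cotangent q1 :=
  differential (fun q => Ld (q0, q)) q1.

Definition nh_momentum (xi : lie_algebra G) (q0 q1 : Q) : R :=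
  D2 q0 q1 (inf_generator act xi q1).

End DiscreteLagrangian.

(* Main.v *)
(** By uniqueness of one-parameter subgroups, [s |-> exp (s xi)] is a
    differentiable curve, so differentiating [Ld (exp (s xi) q1, exp (s xi) q2) = Ld (q1, q2)]
    at [s = 0] gives
    [<D1 Ld (q1, q2), xi_Q q1> + <D2 Ld (q1, q2), xi_Q q2> = 0].
    As [xi_Q q1] lies in [D q1], the projected equation along [D], paired with
    [xi_Q q1], reads [<D1 Ld (q1, q2) + D2 Ld (q0, q1), xi_Q q1> = 0]; subtract.

    Uniqueness needs no differential equation: if [gamma] and [delta] have the
    same velocity at [0], then [k s = gamma s * delta (- s)] has velocity zero
    at [0], and [gamma s * delta (- s) = gamma t * k (s - t) * delta (- t)] has
    velocity zero at every [t], hence is constant. *)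

Require Import Defs.
From mathcomp Require Import all_boot all_order all_algebra sesquilinear.
From mathcomp Require Import all_classical all_reals all_analysis.
Set Implicit Arguments.
Unset Strict Implicit.
Unset Printing Implicit Defensive.
Import Order.TTheory GRing.Theory Num.Theory.
Import numFieldNormedType.Exports.
Local Open Scope classical_set_scope.
Local Open Scope ring_scope.

(** * Calculus of one real variable *)

Section OneVariable.
Context {R : realType}.

Lemma is_derive1_comp (V W : normedModType R) (f : R -> V) (F : V -> W) (t : R) :
  derivable f t 1 -> differentiable F (f t) ->
  is_derive t 1 (F \o f) ('d F (f t) ('D_1 f t)).
Proof.
move=> /derivable1_diffP df dF.
have dFf : differentiable (F \o f) t by exact: differentiable_comp.
by apply: DeriveDef; [exact: diff_derivable | rewrite !deriveE// diff_comp].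
Qed.

Lemma is_derive_affine (a b t : R) : is_derive t 1 (fun s : R => a * s + b) a.
Proof. by apply: is_derive_eq; rewrite addr0 [LHS]mulr1. Qed.

Lemma is_derive1_affine (V : normedModType R) (f : R -> V) (a b t : R) :
  derivable f (a * t + b) 1 ->
  is_derive t 1 (fun s => f (a * s + b)) (a *: 'D_1 f (a * t + b)).
Proof.
move=> /derivable1_diffP df.
have da := is_derive_affine a b t.
have := @is_derive1_comp _ _ (fun s : R => a * s + b) f t
  (@ex_derive _ _ _ _ _ _ _ da) df.
(* The inner derivative [a] is written as [a * 1], so that linearity of the differential pulls the
   factor [a] out. *)
by rewrite derive_val -[X in 'd _ _ X]mulr1 linearZ /= -deriveE.
Qed.

Lemma derive0_cst_itv (f : R -> R) (a b : R) : a <= b ->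
  (forall x, x \in `[a, b] -> is_derive x 1 f 0) -> f b = f a.
Proof.
rewrite le_eqVlt => /predU1P[->//|ab] df.
have sub x : x \in `]a, b[ -> x \in `[a, b] by exact: subset_itv_oo_cc.
have [|x xab /eqP] := @MVT _ f (fun=> 0) a b ab (fun x xab => df x (sub x xab)).
  by apply: derivable_within_continuous => x /df [].
by rewrite mul0r subr_eq0 => /eqP.
Qed.

(** The mean value theorem is a statement about real functions, so it is applied to each coordinate,
    on the segment between [s] and [t], which stays inside the ball where the derivative
    vanishes. *)
Lemma derive0_locally_cst (n : nat) (f : R -> 'rV[R]_n) (t : R) :
  (\forall s \near t, is_derive (s : R) 1 f 0) -> \forall s \near t, f s = f t.
Proof.
move=> [e /= e0 df]; exists e => //= s ts; apply/rowP => i.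
have dfi x : ball t e x -> is_derive x 1 (fun y => f y ord0 i) 0.
  move=> /df [dx vx]; apply: DeriveDef; first by move/derivable_mxP: dx => /(_ ord0 i).
  by move: vx; rewrite derive_mx// => /rowP/(_ i); rewrite !mxE.
have [st|st] := leP s t.
  apply/esym; apply: (@derive0_cst_itv (fun y => f y ord0 i)) => // x.
  rewrite in_itv/= => /andP[sx xt]; apply: dfi; rewrite /ball/= ger0_norm ?subr_ge0//.
  by apply: le_lt_trans ts; rewrite ger0_norm ?subr_ge0// lerD2l lerN2.
apply: (@derive0_cst_itv (fun y => f y ord0 i)); first exact: ltW.
move=> x; rewrite in_itv/= => /andP[tx xs]; apply: dfi.
rewrite /ball/= distrC ger0_norm ?subr_ge0//.
by apply: le_lt_trans ts; rewrite distrC ger0_norm ?subr_ge0 ?(ltW st)// lerD2r.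
Qed.

(** The preimage of every subset of [T] is open, hence each fibre is both open and closed, and the
    line is connected. No topology on [T] enters. *)
Lemma locally_cst_cst (T : Type) (f : R -> T) :
  (forall t, \forall s \near t, f s = f t) -> forall s t, f s = f t.
Proof.
move=> fl s t.
have oA (B : set T) : open (f @^-1` B).
  rewrite openE => x /= Bx; rewrite /interior /=.
  by near=> y; rewrite /= (near (fl x) y).
suff : (f @^-1` [set f t]) s by [].
suff -> : f @^-1` [set f t] = setT by [].
have /connected_intervalP cT : is_interval [set: R] by [].
apply: cT; first by exists t.
- by exists (f @^-1` [set f t]) => //; rewrite setTI.
- exists (f @^-1` [set f t]); last by rewrite setTI.
  by rewrite -[X in closed X]setCK; apply: open_closedC; apply: (oA (~` _)).
Unshelve. all: by end_near. Qed.

End OneVariable.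

Lemma open_setM (T U : topologicalType) (A : set T) (B : set U) :
  open A -> open B -> open (A `*` B).
Proof.
rewrite !openE => oA oB [a b] [/= /oA Aa /oB Bb].
by exists (A, B).
Qed.

(** * Derivable and stationary curves in a space with charts *)

Section Curves.
Context {R : realType} {T : topologicalType} {V : normedModType R}.
Implicit Types (c : chart T V) (A : set (chart T V)) (gamma : R -> T) (t : R).

Lemma near_chart_dom c gamma t : is_chart c -> {for t, continuous gamma} ->
  chart_dom c (gamma t) -> \forall s \near t, chart_dom c (gamma s).
Proof.
move=> hc cg dg; apply: cg; apply: open_nbhs_nbhs; split=> //.
exact: chart_dom_open.
Qed.

(** By continuity [gamma] stays in the chart domain near [t], where [h \o gamma] equals
    [(h \o chart_inv c) \o (c \o gamma)]; the chain rule applies to the latter. *)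
Lemma is_derive1_chart (W : normedModType R) c gamma t (h : T -> W) :
  is_chart c -> {for t, continuous gamma} -> chart_dom c (gamma t) ->
  derivable (c \o gamma) t 1 ->
  differentiable (h \o chart_inv c) (c (gamma t)) ->
  is_derive t 1 (h \o gamma)
    ('d (h \o chart_inv c) (c (gamma t)) ('D_1 (c \o gamma) t)).
Proof.
move=> hc cg dg dcg dh; apply: near_eq_is_derive (is_derive1_comp dcg dh).
have := near_chart_dom hc cg dg; apply: filterS => s ds /=.
by rewrite chart_funK.
Qed.

(** Continuity is a separate clause: [c] takes arbitrary values outside its domain, so derivability
    of [c \o gamma] does not by itself keep [gamma] in that domain near [t]. *)
Definition derivable_curve A gamma t :=
  {for t, continuous gamma} /\
  forall c, A c -> chart_dom c (gamma t) -> derivable (c \o gamma) t 1.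

(** Zero velocity has the same components in every chart, so the condition can be stated in all
    charts at once, with no transition maps. *)
Definition stationary_curve A gamma t :=
  {for t, continuous gamma} /\
  forall c, A c -> chart_dom c (gamma t) -> is_derive t 1 (c \o gamma) 0.

Lemma stationary_derivable A gamma t :
  stationary_curve A gamma t -> derivable_curve A gamma t.
Proof. by move=> [cg sg]; split=> // c Ac /(sg c Ac)[]. Qed.

Lemma stationary_cst A (p : T) t : stationary_curve A (cst p) t.
Proof.
split; first exact: cvg_cst.
by move=> c _ _; rewrite (_ : c \o cst p = cst (c p)) //; exact: is_derive_cst.
Qed.

Lemma stationary_affine A gamma (a b t : R) :
  stationary_curve A gamma (a * t + b) ->
  stationary_curve A (fun s => gamma (a * s + b)) t.
Proof.
move=> [cg sg]; split.
  apply: (@continuous_comp _ _ _ (fun s => a * s + b) gamma) => //.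
  apply/differentiable_continuous/derivable1_diffP.
  by have [] := is_derive_affine a b t.
move=> c Ac /(sg c Ac)[dg vg].
by apply: is_derive_eq (is_derive1_affine dg) _; rewrite vg scaler0.
Qed.

Lemma derivable_curve_affine A gamma (a b t : R) :
  derivable_curve A gamma (a * t + b) ->
  derivable_curve A (fun s => gamma (a * s + b)) t.
Proof.
move=> [cg sg]; split.
  apply: (@continuous_comp _ _ _ (fun s => a * s + b) gamma) => //.
  apply/differentiable_continuous/derivable1_diffP.
  by have [] := is_derive_affine a b t.
by move=> c Ac /(sg c Ac) dg; have [] := is_derive1_affine dg.
Qed.

End Curves.

(** * Images of curves under smooth maps, and curves in products *)

Section Maps.
Context {R : realType} {T T' : topologicalType} {V V' : normedModType R}.
Implicit Types (c : chart T V) (d : chart T' V').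
Implicit Types (A : set (chart T V)) (B : set (chart T' V')).

Lemma smooth_map_differentiable A B (f : T -> T') c d p :
  smooth_map A B f -> A c -> B d -> is_chart c ->
  chart_dom c p -> chart_dom d (f p) ->
  differentiable ((d \o f) \o chart_inv c) (c p).
Proof.
(* The empty list of directions in [smooth_on] is the differentiability of the map itself. *)
move=> [_ sf] Ac Bd hc cp dfp; apply: (sf c d Ac Bd [::]).
by split; [exact: chart_fun_cod | rewrite /= chart_funK].
Qed.

Lemma derivable_curve_map A B (f : T -> T') c (gamma : R -> T) (t : R) :
  smooth_map A B f -> A c -> is_chart c -> chart_dom c (gamma t) ->
  derivable_curve A gamma t -> derivable_curve B (f \o gamma) t.
Proof.
move=> sf Ac hc cg [g0 g1]; split.
  by apply: continuous_comp => //; apply: sf.1.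
move=> d Bd dg.
have dF := smooth_map_differentiable sf Ac Bd hc cg dg.
by have [] := is_derive1_chart hc g0 cg (g1 c Ac cg) dF.
Qed.

Lemma stationary_curve_map A B (f : T -> T') c (gamma : R -> T) (t : R) :
  smooth_map A B f -> A c -> is_chart c -> chart_dom c (gamma t) ->
  stationary_curve A gamma t -> stationary_curve B (f \o gamma) t.
Proof.
move=> sf Ac hc cg [g0 g1]; split.
  by apply: continuous_comp => //; apply: sf.1.
move=> d Bd dg; have [dv v] := g1 c Ac cg.
have dF := smooth_map_differentiable sf Ac Bd hc cg dg.
apply: is_derive_eq (is_derive1_chart hc g0 cg dv dF) _.
by rewrite v linear0.
Qed.

Lemma is_chart_prod c d : is_chart c -> is_chart d -> is_chart (prod_chart c d).
Proof.
move=> hc hd; split => /=.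
- by apply: open_setM; exact: chart_dom_open.
- by apply: open_setM; exact: chart_cod_open.
- by move=> q [? ?]; split; exact: chart_fun_cod.
- by move=> q [? ?]; split; exact: chart_inv_dom.
- by move=> [p q] [? ?]; rewrite !chart_funK.
- by move=> [p q] [? ?]; rewrite !chart_invK.
- move=> [p q] [/= cp dq]; apply: cvg_pair; apply: cvg_comp.
  + exact: cvg_fst.
  + exact: (chart_fun_continuous hc cp).
  + exact: cvg_snd.
  + exact: (chart_fun_continuous hd dq).
- move=> [p q] [/= cp dq]; apply: cvg_pair; apply: cvg_comp.
  + exact: cvg_fst.
  + exact: (chart_inv_continuous hc cp).
  + exact: cvg_snd.
  + exact: (chart_inv_continuous hd dq).
Qed.

Lemma is_derive1_pair (f : R -> V) (g : R -> V') (t : R) (u : V) (v : V') :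
  is_derive t 1 f u -> is_derive t 1 g v ->
  is_derive t 1 (fun s => (f s, g s)) (u, v).
Proof.
move=> [/derivable1_diffP df <-] [/derivable1_diffP dg <-].
have dfg := differentiable_pair df dg.
apply: DeriveDef; first exact: diff_derivable.
by rewrite !deriveE// diff_pair.
Qed.

Lemma derivable_curve_pair A B (gamma : R -> T) (delta : R -> T') (t : R) :
  derivable_curve A gamma t -> derivable_curve B delta t ->
  derivable_curve (prod_atlas A B) (fun s => (gamma s, delta s)) t.
Proof.
move=> [g0 g1] [d0 d1]; split; first exact: cvg_pair.
move=> _ [c [d [Ac Bd ->]]] [/= cg dd].
by have [] := is_derive1_pair (derivableP (g1 c Ac cg)) (derivableP (d1 d Bd dd)).
Qed.

Lemma stationary_curve_pair A B (gamma : R -> T) (delta : R -> T') (t : R) :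
  stationary_curve A gamma t -> stationary_curve B delta t ->
  stationary_curve (prod_atlas A B) (fun s => (gamma s, delta s)) t.
Proof.
move=> [g0 g1] [d0 d1]; split; first exact: cvg_pair.
move=> _ [c [d [Ac Bd ->]]] [/= cg dd].
exact: is_derive1_pair (g1 c Ac cg) (d1 d Bd dd).
Qed.

(** The differential of [F] at the common point is linear and [(u, v) = (u, 0) + (0, v)]. This
    serves both the multiplication of the group and the discrete Lagrangian. *)
Lemma derive1_prod (W : normedModType R) (F : T * T' -> W) c d
    (gamma : R -> T) (delta : R -> T') (t : R) :
  is_chart c -> is_chart d ->
  chart_dom c (gamma t) -> chart_dom d (delta t) ->
  {for t, continuous gamma} -> {for t, continuous delta} ->
  derivable (c \o gamma) t 1 -> derivable (d \o delta) t 1 ->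
  differentiable (F \o chart_inv (prod_chart c d))
    (prod_chart c d (gamma t, delta t)) ->
  is_derive t 1 (fun s => F (gamma s, delta s))
    ('D_1 (fun s => F (gamma s, delta t)) t +
     'D_1 (fun s => F (gamma t, delta s)) t).
Proof.
move=> hc hd cg dd g0 d0 g1 d1 dF.
have hcd := is_chart_prod hc hd.
(* The derivative of [F] along a pair of curves through the given point depends only on their
   velocities. It is applied three times: with both curves moving, then with either one frozen. *)
have push (a : R -> T) (b : R -> T') u v : a t = gamma t -> b t = delta t ->
    {for t, continuous a} -> {for t, continuous b} ->
    is_derive t 1 (c \o a) u -> is_derive t 1 (d \o b) v ->
    is_derive t 1 (fun s => F (a s, b s))
      ('d (F \o chart_inv (prod_chart c d)) (prod_chart c d (gamma t, delta t))
        (u, v)).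
  move=> at_ bt a0 b0 au bv.
  have [dab vab] := is_derive1_pair au bv.
  have := @is_derive1_chart _ _ _ _ (prod_chart c d) (fun s => (a s, b s)) t F hcd.
  rewrite at_ bt -vab; apply=> //.
  by apply: cvg_pair.
have kc (U : topologicalType) (p : U) : {for t, continuous (fun _ : R => p)}.
  exact: cvg_cst.
have sum := push _ _ _ _ erefl erefl g0 d0 (derivableP g1) (derivableP d1).
have [_ v1] := push _ _ _ _ erefl erefl g0 (kc _ (delta t)) (derivableP g1)
  (is_derive_cst (d (delta t)) _ _).
have [_ v2] := push _ _ _ _ erefl erefl (kc _ (gamma t)) d0
  (is_derive_cst (c (gamma t)) _ _) (derivableP d1).
apply: is_derive_eq sum _; rewrite v1 v2 -linearD; congr ('d _ _ _).
by congr pair; rewrite /= ?addr0 ?add0r.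
Qed.

End Maps.

(** * Velocities and differentials on a manifold *)

Section Manifolds.
Context {R : realType} {n : nat} {M : manifoldType R n}.
Implicit Types (q : M) (gamma : R -> M).

Lemma chart_at_atlas q : atlas M (chart_at q).
Proof. exact: s2valP (cid2 (atlas_cover q)). Qed.

Lemma chart_at_dom q : chart_dom (chart_at q) q.
Proof. exact: s2valP' (cid2 (atlas_cover q)). Qed.

Lemma chart_at_is_chart q : is_chart (chart_at q).
Proof. exact: atlas_chart (chart_at_atlas q). Qed.

Lemma velocityE q gamma : velocity q gamma = 'D_1 (chart_at q \o gamma) 0.
Proof. exact: derive1E. Qed.

Lemma differential_velocity (f : M -> R) q gamma : gamma 0 = q ->
  derivable_curve (atlas M) gamma 0 ->
  differentiable (f \o chart_inv (chart_at q) : 'rV[R]_n -> R^o) (chart_at q q) ->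
  differential f q (velocity q gamma) = 'D_1 ((f : M -> R^o) \o gamma) 0.
Proof.
move=> g0 [cg dg] df; rewrite /differential lfunE velocityE /=.
have hq : chart_dom (chart_at q) (gamma 0) by rewrite g0; exact: chart_at_dom.
have := @is_derive1_chart R M _ _ (chart_at q) gamma 0 f (chart_at_is_chart q)
  cg hq (dg _ (chart_at_atlas q) hq).
by rewrite g0 => /(_ df)[].
Qed.

Lemma smooth_curve_derivable gamma t :
  smooth_map (@model_atlas R R^o) (atlas M) gamma ->
  derivable_curve (atlas M) gamma t.
Proof.
move=> [cg sg]; split; first exact: cg.
move=> c Ac ct; apply: diff_derivable.
by apply: (sg _ c erefl Ac [::]).
Qed.

(** [velocity] is read in the preferred chart at [q]; the differential of the transition map, which
    is the same for both curves, carries the equality to any other chart around [q]. *)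
Lemma derive1_chart_eq q c gamma delta (t : R) :
  derivable_curve (atlas M) gamma t -> derivable_curve (atlas M) delta t ->
  gamma t = q -> delta t = q -> atlas M c -> chart_dom c q ->
  'D_1 (chart_at q \o gamma) t = 'D_1 (chart_at q \o delta) t ->
  'D_1 (c \o gamma) t = 'D_1 (c \o delta) t.
Proof.
move=> [g0 g1] [d0 d1] gt dt Ac cq v.
have dom := chart_at_dom q.
have dc : differentiable (c \o chart_inv (chart_at q)) (chart_at q q).
  have /= := @atlas_compat R n M _ _ (chart_at_atlas q) Ac [::] (chart_at q q).
  apply; split; first exact: chart_fun_cod (chart_at_is_chart q) _ dom.
  by rewrite /= (chart_funK (chart_at_is_chart q)).
have ch (a : R -> M) : {for t, continuous a} -> a t = q ->
    derivable (chart_at q \o a) t 1 ->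
    'D_1 (c \o a) t = 'd (c \o chart_inv (chart_at q)) (chart_at q q)
                        ('D_1 (chart_at q \o a) t).
  move=> a0 at_ a1.
  have := @is_derive1_chart R M _ _ (chart_at q) a t c (chart_at_is_chart q) a0.
  by rewrite at_ => /(_ dom a1 dc)[].
rewrite !ch ?v//; [apply: d1|apply: g1]; rewrite ?gt ?dt//; exact: chart_at_atlas.
Qed.

(** Near each [t] the curve stays in one chart, where its coordinates have zero derivative and are
    therefore constant; applying the inverse chart makes the curve locally constant, hence
    constant. *)
Lemma stationary_cst_curve gamma :
  (forall t, stationary_curve (atlas M) gamma t) -> forall s t, gamma s = gamma t.
Proof.
move=> sg; apply: locally_cst_cst => t.
set c := chart_at (gamma t); have hc := chart_at_is_chart (gamma t).
have near_c := near_chart_dom hc (sg t).1 (chart_at_dom (gamma t)).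
have : \forall s \near t, (c \o gamma) s = (c \o gamma) t.
  apply: derive0_locally_cst; apply: filterS near_c => s.
  exact: (sg s).2 (chart_at_atlas _).
apply: filterS2 near_c => s cs /(congr1 (chart_inv c)) /=.
by rewrite !(chart_funK hc)//; exact: chart_at_dom.
Qed.

End Manifolds.

(** These are the three facts about a chart around [(x, y)] that transporting a curve by a smooth
    map out of a product requires. *)
Lemma prod_chart_at (R : realType) (m n : nat) (M : manifoldType R m)
    (N : manifoldType R n) (x : M) (y : N) : [/\
  prod_atlas (atlas M) (atlas N) (prod_chart (chart_at x) (chart_at y)),
  is_chart (prod_chart (chart_at x) (chart_at y)) &
  chart_dom (prod_chart (chart_at x) (chart_at y)) (x, y)].
Proof.
split.
- exists (chart_at x), (chart_at y); split=> //; exact: chart_at_atlas.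
- by apply: is_chart_prod; exact: chart_at_is_chart.
- by split; exact: chart_at_dom.
Qed.

(** * Uniqueness of one-parameter subgroups *)

Section OneParameterSubgroups.
Context {R : realType} {m : nat} {G : lieGroupType R m}.
Implicit Types (gamma delta : R -> G) (xi : lie_algebra G).
Local Open Scope group_scope.

(** The algebraic clause of [one_param_subgroup], isolated because uniqueness then asks for
    derivability at [0] only. *)
Definition one_param_hom gamma :=
  forall s t, gamma (s + t)%R = gamma s * gamma t.

Lemma one_param_hom0 gamma : one_param_hom gamma -> gamma 0%R = 1.
Proof.
move=> hg; apply: (mulgI (gamma 0%R)); rewrite -hg mulg1.
by congr gamma; exact: addr0.
Qed.

Lemma one_param_homN gamma t : one_param_hom gamma ->
  gamma t * gamma (- t)%R = 1.
Proof. by move=> hg; rewrite -hg subrr one_param_hom0. Qed.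

Lemma derivable_curve_mulg gamma delta (t : R) :
  derivable_curve (atlas G) gamma t -> derivable_curve (atlas G) delta t ->
  derivable_curve (atlas G) (fun s => gamma s * delta s) t.
Proof.
move=> dg dd; have [Ac hc dc] := prod_chart_at (gamma t) (delta t).
exact: (derivable_curve_map mulg_smooth Ac hc dc (derivable_curve_pair dg dd)).
Qed.

Lemma stationary_curve_mulg gamma delta (t : R) :
  stationary_curve (atlas G) gamma t -> stationary_curve (atlas G) delta t ->
  stationary_curve (atlas G) (fun s => gamma s * delta s) t.
Proof.
move=> dg dd; have [Ac hc dc] := prod_chart_at (gamma t) (delta t).
exact: (stationary_curve_map mulg_smooth Ac hc dc (stationary_curve_pair dg dd)).
Qed.

(** At [(1, 1)] both partial maps of the multiplication are the identity, so by [derive1_prod] the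
    velocity of the product is that of [gamma] minus that of [delta], in any chart around [1]. *)
Lemma stationary_mulgN gamma delta :
  gamma 0%R = 1 -> delta 0%R = 1 ->
  derivable_curve (atlas G) gamma 0%R -> derivable_curve (atlas G) delta 0%R ->
  velocity 1 gamma = velocity 1 delta ->
  stationary_curve (atlas G) (fun s => gamma s * delta (- s)%R) 0%R.
Proof.
move=> g0 d0 dg dd v.
have Ndelta : (fun s => delta (- s)%R) = (fun s => delta ((- 1) * s + 0)%R).
  by apply/funext => s; rewrite mulN1r addr0.
have N0 : ((- 1) * 0 + 0 = 0 :> R)%R by rewrite mulr0 addr0.
have dN : derivable_curve (atlas G) (fun s => delta (- s)%R) 0%R.
  by rewrite Ndelta; apply: derivable_curve_affine; rewrite N0.
split; first exact: (derivable_curve_mulg dg dN).1.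
move=> c Ac; rewrite oppr0 g0 d0 mulg1 => c1.
have e1 := chart_at_dom (1 : G); have Ae := chart_at_atlas (1 : G).
have he := chart_at_is_chart (1 : G).
have := @derive1_prod R G G _ _ _ (c \o (fun p : G * G => p.1 * p.2))
  (chart_at 1) (chart_at 1) gamma (fun s => delta (- s)%R) 0%R he he.
rewrite oppr0 g0 d0 => /(_ e1 e1 dg.1 dN.1).
have dcg : derivable (chart_at 1 \o gamma) 0%R 1%R by apply: dg.2; rewrite ?g0.
have dcd : derivable (chart_at 1 \o (fun s => delta (- s)%R)) 0%R 1%R.
  by apply: dN.2; rewrite ?oppr0 ?d0.
have [Ap hp dp] := prod_chart_at (1 : G) (1 : G).
have c11 : chart_dom c (1 * 1) by rewrite mulg1.
have dF := smooth_map_differentiable mulg_smooth Ap Ac hp dp c11.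
move=> /(_ dcg dcd dF) sum.
apply: is_derive_eq sum _.
have -> : (fun s : R => (c \o (fun p : G * G => p.1 * p.2)) (gamma s, 1)) =
    c \o gamma.
  by apply/funext => s /=; rewrite mulg1.
have -> : (fun s : R =>
      (c \o (fun p : G * G => p.1 * p.2)) (1, delta (- s)%R)) =
    (fun s => (c \o delta) ((- 1) * s + 0)%R).
  by apply/funext => s /=; rewrite mul1g mulN1r addr0.
have dd' : derivable (c \o delta) ((- 1) * 0 + 0)%R 1%R.
  by rewrite N0; apply: dd.2; rewrite ?d0.
have [_ ->] := is_derive1_affine dd'.
rewrite N0 (derive1_chart_eq dg dd g0 d0 Ac c1).
  by rewrite scaleN1r subrr.
by move: v; rewrite !velocityE.
Qed.

Lemma one_param_hom_unique gamma delta :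
  one_param_hom gamma -> one_param_hom delta ->
  derivable_curve (atlas G) gamma 0%R -> derivable_curve (atlas G) delta 0%R ->
  velocity 1 gamma = velocity 1 delta -> gamma =1 delta.
Proof.
move=> hg hd dg dd v.
have sk := stationary_mulgN (one_param_hom0 hg) (one_param_hom0 hd) dg dd v.
suff h1 t : gamma t * delta (- t)%R = 1.
  move=> t; apply: (mulIg (delta (- t)%R)).
  by rewrite h1 one_param_homN.
(* The constant value of the product is read off at time [0]. *)
rewrite (_ : 1 = gamma 0%R * delta (- 0)%R); last first.
  by rewrite oppr0 !one_param_hom0// mulg1.
apply: (@stationary_cst_curve _ _ G (fun t => gamma t * delta (- t)%R)) => {}t.
(* The argument is spelled [1 * s - t] to match the affine reparametrization of [stationary_affine]
   with slope [1] and offset [- t], which sends time [t] to [0]. *)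
have -> : (fun s : R => gamma s * delta (- s)%R) =
    (fun s => gamma t *
      (gamma (1 * s - t)%R * delta (- (1 * s - t))%R) * delta (- t)%R).
  apply/funext => s; rewrite mul1r !mulgA -hg [(t + _)%R]addrC subrK -mulgA -hd.
  by rewrite opprB addrAC subrr add0r.
apply: stationary_curve_mulg; last exact: stationary_cst.
apply: stationary_curve_mulg; first exact: stationary_cst.
apply: (@stationary_affine _ _ _ _ (fun s => gamma s * delta (- s)%R)).
by rewrite mul1r subrr.
Qed.

End OneParameterSubgroups.

(** * The exponential map along a line in the Lie algebra *)

Lemma smooth_on_scale (R : realType) (V W : normedModType R) (U : set V)
    (f : V -> W) (a : R) :
  smooth_on U f -> smooth_on (( *:%R a) @^-1` U) (f \o *:%R a).
Proof.
move=> sf vs x Ux.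
have -> : foldr (fun v h => 'D_v h) (f \o *:%R a) vs =
    foldr (fun v h => 'D_v h) f (map ( *:%R a) vs) \o *:%R a.
  elim: vs => //= v vs ->; apply/funext => y /=.
  (* Both difference quotients are the same function of [h], so their limits agree with no
     differentiability assumed and also for [a = 0]. *)
  rewrite /derive; set p := (fun h : R => _); set p' := (fun h : R => _).
  suff -> : p = p' by []; apply/funext => h; rewrite /p /p' /=.
  by rewrite [a *: (_ + _)]scalerDr !scalerA mulrC.
by apply: differentiable_comp; [exact: ex_diff | exact: sf].
Qed.

Section Exponential.
Context {R : realType} {m : nat} {G : lieGroupType R m}.
Implicit Types (gamma : R -> G) (xi : lie_algebra G).

(** Rescaling time turns a subgroup for [xi] into one for [a *: xi]; evaluated at time [1] it
    identifies [exp (s xi)] with [gamma s] for every [s], including [0]. *)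
Lemma one_param_subgroup_affine gamma xi (a : R) : one_param_subgroup xi gamma ->
  one_param_subgroup (a *: xi) (fun s => gamma (a * s)).
Proof.
move=> [sg hg vg]; split.
- split.
    move=> t; apply: (@continuous_comp _ _ _ ( *:%R a : R^o -> R^o) gamma).
      exact: scaler_continuous.
    exact: sg.1.
  move=> c d -> Ad; exact: (smooth_on_scale (a := a) (sg.2 _ _ erefl Ad)).
- by move=> s t; rewrite mulrDr hg.
- have g0 : gamma 0 = 1%g by exact: one_param_hom0.
  have Ea : chart_at (1%g : G) \o (fun s => gamma (a * s)) =
      (fun s => (chart_at 1%g \o gamma) (a * s + 0)).
    by apply/funext => s /=; rewrite addr0.
  have N0 : a * 0 + 0 = 0 by rewrite mulr0 addr0.
  have dg : derivable (chart_at 1%g \o gamma) (a * 0 + 0) 1.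
    rewrite N0; apply: (smooth_curve_derivable 0 sg).2 => //.
      exact: chart_at_atlas.
    by rewrite g0; exact: chart_at_dom.
  rewrite velocityE Ea; have [_ ->] := is_derive1_affine dg.
  by rewrite N0 -velocityE vg.
Qed.

(** [lie_exp] is a choice from a set of endpoints, and by uniqueness of the subgroup that set has a
    single element. *)
Lemma lie_expE gamma xi : one_param_subgroup xi gamma -> lie_exp xi = gamma 1.
Proof.
move=> h; apply: xget_unique; first by exists gamma.
move=> _ [delta [sd hd vd] <-]; case: h => sg hg vg.
apply: one_param_hom_unique => //; try exact: smooth_curve_derivable.
by rewrite vd vg.
Qed.

(* Without an existence theorem for one-parameter subgroups, [lie_exp] may take
   its default value [1]; the curve is then constant. *)
Lemma lie_exp_derivable xi :
  derivable_curve (atlas G) (fun s : R => lie_exp (s *: xi)) 0 /\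
  lie_exp (0 *: xi) = 1%g.
Proof.
have [[gamma hgamma]|nex] := pselect (exists gamma, one_param_subgroup xi gamma).
  have E : (fun s : R => lie_exp (s *: xi)) = gamma.
    apply/funext => s; rewrite (lie_expE (one_param_subgroup_affine s hgamma)).
    by rewrite mulr1.
  have -> : lie_exp (0 *: xi) = gamma 0 by rewrite -E.
  rewrite E; case: hgamma => sg hg _; split; last exact: one_param_hom0.
  exact: smooth_curve_derivable.
suff E s : lie_exp (s *: xi) = 1%g.
  split=> //; rewrite (_ : (fun s => _) = cst 1%g); last exact/funext.
  exact/stationary_derivable/stationary_cst.
rewrite /lie_exp; case: xgetP => // _ _ [gamma hgamma <-].
(* For [s] nonzero, a subgroup for [s *: xi] rescaled by [s^-1] would be one for [xi], against
   [nex]. For [s = 0] its velocity is zero, so by uniqueness it is the trivial subgroup. *)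
have [s0|s0] := eqVneq s 0; last first.
  case: nex; exists (fun t => gamma (s^-1 * t)).
  have := one_param_subgroup_affine s^-1 hgamma.
  by rewrite scalerA mulVf// scale1r.
case: hgamma => sg hg vg.
apply: (@one_param_hom_unique _ _ _ gamma (cst 1%g) hg).
- by move=> ? ?; rewrite mulg1.
- exact: smooth_curve_derivable.
- exact/stationary_derivable/stationary_cst.
- rewrite vg s0 scale0r velocityE.
  by rewrite (_ : _ \o cst _ = cst (chart_at (1%g : G) 1%g))// derive_cst.
Qed.

End Exponential.

(** * Infinitesimal invariance and conservation of the momentum *)

Section Noether.
Context {R : realType} {n m : nat} {Q : manifoldType R n}
  {G : lieGroupType R m}.

(** The projection onto [D q] along [dist_perp g D q] fixes [D q] once the two subspaces meet only
    in [0]; a nonzero common vector would be orthogonal to itself, against positivity of the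
    metric. *)
Lemma proj_dist_id (r : nat) (g : riemannian_metric Q)
    (D : smooth_distribution Q r) q (v : tangent q) :
  v \in D q -> proj_dist g D q v = v.
Proof.
apply: daddv_pi_id; apply/eqP; rewrite -subv0; apply/subvP => u.
rewrite memv_cap memv0 => /andP[uD /mem_orthovP/(_ u uD) uu].
apply: contraTT isT => u0.
by have := neq0_dnorm_gt0 (s := g q) u u0; rewrite uu ltxx.
Qed.

Variables (act : G -> Q -> Q) (hact : smooth_action act).

(** The orbit is the image under the action of the curve [(exp (s xi), q)], whose second component
    is constant. *)
Lemma orbit_derivable xi q :
  let gamma (s : R) := act (lie_exp (s *: xi)) q in
  derivable_curve (atlas Q) gamma 0 /\ gamma 0 = q.
Proof.
move=> gamma; have [sact act1 _] := hact; have [de e0] := lie_exp_derivable xi.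
have g0 : gamma 0 = q by rewrite /gamma e0 act1.
split=> //.
have [Ac hc cd] := prod_chart_at (1%g : G) q.
have dc := derivable_curve_pair de
  (stationary_derivable (stationary_cst (atlas Q) q 0)).
apply: (derivable_curve_map sact Ac hc _ dc).
by rewrite e0.
Qed.

Variables (Ld : Q * Q -> R) (hLd : smooth_lagrangian Ld).

Lemma differentiable_lagrangian p q :
  differentiable
    ((Ld : Q * Q -> R^o) \o chart_inv (prod_chart (chart_at p) (chart_at q)))
    (chart_at p p, chart_at q q).
Proof.
have [Ac hc cd] := prod_chart_at p q.
exact: (@smooth_map_differentiable _ _ _ _ _ _ _ Ld _ _ (p, q) hLd Ac erefl hc).
Qed.

Lemma D1E p q (gamma : R -> Q) : gamma 0 = p ->
  derivable_curve (atlas Q) gamma 0 ->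
  D1 Ld p q (velocity p gamma) = 'D_1 (fun s => Ld (gamma s, q) : R^o) 0.
Proof.
move=> g0 dg; apply: differential_velocity => //.
(* In charts, freezing the second argument is precomposition with a slice inclusion, so
   differentiability follows from that of [Ld] in the product chart. *)
have -> : (fun q' => Ld (q', q)) \o chart_inv (chart_at p) =
    (Ld \o chart_inv (prod_chart (chart_at p) (chart_at q))) \o
      (fun x => (x, chart_at q q)).
  apply/funext => x /=.
  by rewrite (chart_funK (chart_at_is_chart q)) //; exact: chart_at_dom.
apply: differentiable_comp; last exact: differentiable_lagrangian.
exact: differentiable_pair.
Qed.

Lemma D2E p q (gamma : R -> Q) : gamma 0 = q ->
  derivable_curve (atlas Q) gamma 0 ->
  D2 Ld p q (velocity q gamma) = 'D_1 (fun s => Ld (p, gamma s) : R^o) 0.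
Proof.
move=> g0 dg; apply: differential_velocity => //.
have -> : (fun q' => Ld (p, q')) \o chart_inv (chart_at q) =
    (Ld \o chart_inv (prod_chart (chart_at p) (chart_at q))) \o
      (fun x => (chart_at p p, x)).
  apply/funext => x /=.
  by rewrite (chart_funK (chart_at_is_chart p)) //; exact: chart_at_dom.
apply: differentiable_comp; last exact: differentiable_lagrangian.
exact: differentiable_pair.
Qed.

Hypothesis hinv : invariant_lagrangian act Ld.

Lemma infinitesimal_invariance xi p q :
  D1 Ld p q (inf_generator act xi p) + D2 Ld p q (inf_generator act xi q) = 0.
Proof.
have [dp p0] := orbit_derivable xi p; have [dq q0] := orbit_derivable xi q.
(* Each pairing becomes the derivative of [Ld] with one argument moving along its orbit and the
   other fixed; [derive1_prod] adds them into the derivative with both moving. *)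
apply: etrans (congr2 +%R (D1E q p0 dp) (D2E p q0 dq)) _.
have hp := chart_at_is_chart p; have hq := chart_at_is_chart q.
have := @derive1_prod R Q Q _ _ R^o Ld (chart_at p) (chart_at q) _ _ 0 hp hq.
move=> /(_ _ _ _ _ dp.1 dq.1); rewrite p0 q0.
move=> /(_ (chart_at_dom p) (chart_at_dom q)).
move=> /(_ (dp.2 _ (chart_at_atlas p) _) (dq.2 _ (chart_at_atlas q) _)).
rewrite p0 q0 => /(_ (chart_at_dom p) (chart_at_dom q)).
move=> /(_ (differentiable_lagrangian p q))[_ <-].
(* With both arguments moved by the same group element, invariance makes the function of [s]
   constant. *)
rewrite (_ : (fun s => _) = cst (Ld (p, q))) ?derive_cst//.
by apply/funext => s; exact: hinv.
Qed.

End Noether.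

Theorem corollary4 (R : realType) (n : nat) (Q : manifoldType R n)
  (g : riemannian_metric Q) (r : nat) (D : smooth_distribution Q r)
  (m : nat) (G : lieGroupType R m)
  (act : G -> Q -> Q) (hact : smooth_action act)
  (Ld : Q * Q -> R) (hLd : smooth_lagrangian Ld)
  (hinv : invariant_lagrangian act Ld)
  (xi : lie_algebra G) (hxi : horizontal_symmetry act D xi)
  (q0 q1 q2 : Q)
  (hP : dual_map (proj_dist g D q1) (D1 Ld q1 q2)
        + dual_map (proj_dist g D q1) (D2 Ld q0 q1) = 0)
  (hQ : dual_map (proj_perp g D q1) (D1 Ld q1 q2)
        - dual_map (proj_perp g D q1) (D2 Ld q0 q1) = 0) :
  nh_momentum act Ld xi q1 q2 = nh_momentum act Ld xi q0 q1.
Proof.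
have := congr1 (fun f : cotangent q1 => f (inf_generator act xi q1)) hP.
rewrite add_lfunE zero_lfunE !comp_lfunE proj_dist_id ?hxi// => h1.
have h2 := infinitesimal_invariance hact hLd hinv xi q1 q2.
(* Adding this pairing to either momentum gives [0]: by [h2] for the new one, by [h1] for the old
   one. *)
apply: (addrI (D1 Ld q1 q2 (inf_generator act xi q1))).
by rewrite /nh_momentum h1 h2.
Qed.
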